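(* A paramedial left cancellative $k$-translatable semigroup is a cyclic group.
   Context: A groupoid is a set with a binary operation $\cdot$; a semigroup is an associative groupoid. It is left cancellative if $x\cdot y=x\cdot z$ implies $y=z$. It is paramedial if $(i\cdot j)\cdot(w\cdot z)=(z\cdot j)\cdot(w\cdot i)$ for all $i,j,w,z$. For an integer $x$, $[x]_n$ denotes the residue of $x$ modulo $n$, represented in $\{1,\ldots,n\}$, with $0$ identified with $n$. All groupoids are finite and taken to be of the form $Q=\{1,\ldots,n\}$ with the natural ordering. For $1\le k<n$, $Q$ is $k$-translatable if in its multiplication table each row $i$, $2\le i\le n$, is obtained from row $i-1$ by cyclically shifting it $k$ places to the right, i.e. $i\cdot j=(i-1)\cdot[j-k]_n$ for all $j$ and all $2\le i\le n$. *)

(* Defs.v *)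
From HB Require Import structures.
From mathcomp Require Import all_boot all_order all_algebra all_fingroup all_solvable.

Set Implicit Arguments.
Unset Strict Implicit.
Unset Printing Implicit Defensive.

Section Identities.
Variables (T : Type) (op : T -> T -> T).

(* Not to be confused with the library's [left_injective op], which says that
   [op^~ x] is injective, i.e. right cancellation. *)
Definition left_cancellative := forall x y z : T, op x y = op x z -> y = z.

Definition paramedial :=
  forall i j w z : T, op (op i j) (op w z) = op (op z j) (op w i).

End Identities.

(* [x]_n, the representative of x modulo n lying in {1, ..., n}. *)
Definition residue (n : nat) (x : int) : nat :=
  let r := absz (modz x (Posz n)) in if r == 0 then n else r.

(* The carrier {1, ..., n} is modelled by 'I_n, whose inhabitant of value m
   stands for the number m + 1. *)
Definition label (n : nat) (i : 'I_n) : nat := (val i).+1.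

(* i . j = (i - 1) . [j - k]_n for 2 <= i <= n and all j, where i' and j' are
   the elements numbered i - 1 and [j - k]_n. *)
Definition translatable (n k : nat) (op : 'I_n -> 'I_n -> 'I_n) :=
  forall i i' j j' : 'I_n,
    2 <= label i ->
    label i' = (label i).-1 ->
    label j' = residue n (Posz (label j) - Posz k)%R ->
    op i j = op i' j'.

(* The type T itself, equipped with the group structure whose product is op. *)
Definition groupoid_group (T : finType) (op : T -> T -> T) (e : T)
  (inv : T -> T) (opA : associative op) (op1 : left_id e op)
  (opV : left_inverse e inv op) : Type := T.

Section GroupoidGroup.
Variables (T : finType) (op : T -> T -> T) (e : T) (inv : T -> T).
Variables (opA : associative op) (op1 : left_id e op).
Variable (opV : left_inverse e inv op).

HB.instance Definition _ := Finite.on (groupoid_group opA op1 opV).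
HB.instance Definition _ :=
  Finite_isGroup.Build (groupoid_group opA op1 opV) opA op1 opV.

End GroupoidGroup.

Definition is_cyclic_group (T : finType) (op : T -> T -> T) : Prop :=
  exists (e : T) (inv : T -> T) (opA : associative op) (op1 : left_id e op)
         (opV : left_inverse e inv op),
    cyclic [set: groupoid_group opA op1 opV].

(* Main.v *)
Require Import Defs.
From mathcomp Require Import all_boot.
From mathcomp Require Import all_algebra all_fingroup all_solvable.
From mathcomp Require Import zify ring.

Import GRing.Theory.

(** Three facts combine.  In a finite left cancellative semigroup the equation
    [x * e = x] is solvable and its solution is a left identity
    ([left_cancellative_left_id]).  Paramediality read at [(e e)(e a)] then
    exchanges [a] with the outer [e], so a left identity is two-sided
    ([paramedial_right_id]).

    Number the elements by the residues modulo n.  Translatability means that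
    the whole table is determined by its first row: [i * j = 0 * (j - i k)]
    ([translatableE]).  The row of the identity [e] is known, [e * j = j], and
    it determines the first row; what remains is
    [i * j = j - i k + e k].  The column of [e] is known as well,
    [i * e = i], and forces [k = -1].  Hence [i * j = i + j - e]
    ([translatable_idE]): the operation is addition modulo n with its origin
    moved to [e], and the successor of [e] generates. *)

Lemma left_cancellative_left_id (T : finType) (op : T -> T -> T) (x : T) :
  associative op -> left_cancellative op -> exists e, left_id e op.
Proof.
move=> opA opI; have inj_x : injective (op x) by move=> y z; apply: opI.
by exists (invF inj_x x) => y; apply: (opI x); rewrite opA f_invF.
Qed.

Lemma paramedial_right_id (T : Type) (op : T -> T -> T) (e : T) :
  associative op -> paramedial op -> left_id e op -> right_id e op.
Proof.
by move=> opA opP op1 a; have := opP e e e a; rewrite !op1 -opA op1.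
Qed.

Section Translatable.
Variables (m k : nat).
Local Notation Zn := 'I_m.+2.
Variable op : Zn -> Zn -> Zn.

Local Open Scope ring_scope.

(** The shift by one between labels and residues cancels on both sides, so the
    column labelled [j - k] is the residue [j - k] itself. *)
Lemma label_sub (j : Zn) : (1 <= k < m.+2)%N ->
  label (j - k%:R) = residue m.+2 ((label j)%:Z - k%:Z).
Proof.
move=> /andP[k_gt0 k_lt]; rewrite /label /residue.
have -> : val (j - k%:R) = ((j + (m.+2 - k)) %% m.+2)%N.
  have kE : val (k%:R : Zn) = k by rewrite [LHS](@val_Zp_nat m.+2) ?modn_small.
  by rewrite -[in RHS]kE /= modnDmr.
have j_lt := ltn_ord j; rewrite /= in j_lt *.
have [le_kj | lt_jk] := leqP k j.
- have -> : (j + (m.+2 - k) = (j - k) + m.+2)%N by lia.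
  have -> : j.+1%:Z - k%:Z = (j - k).+1%:Z by rewrite subzn ?subSn // leqW.
  by rewrite modnDr modn_small ?modz_nat ?modn_small //=; lia.
- rewrite modn_small; last lia.
  have [jk | neq] := eqVneq (j.+1 : nat) k.
    by rewrite -jk subrr mod0z /=; lia.
  have eqZ : j.+1%:Z - k%:Z + m.+2%:Z = (j + (m.+2 - k)).+1%:Z.
    by rewrite addrAC -PoszD subzn; [congr Posz; lia | lia].
  by rewrite -modzDr eqZ modz_nat modn_small //; lia.
Qed.

Lemma translatableE : (1 <= k < m.+2)%N -> translatable k op ->
  forall i j : Zn, op i j = op 0 (j - i * k%:R).
Proof.
move=> k_bd opT [i]; elim: i => [|i IHi] lt_i j.
  by rewrite (_ : Ordinal lt_i = 0) ?mul0r ?subr0 //; apply: val_inj.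
have lt_i' := ltnW lt_i.
rewrite (opT _ (Ordinal lt_i') _ (j - k%:R)) ?label_sub // IHi.
have -> : Ordinal lt_i = Ordinal lt_i' + 1.
  by apply: val_inj; rewrite /= addn1 modn_small.
by congr (op 0 _); ring.
Qed.

Lemma translatable_idE (e : Zn) : (1 <= k < m.+2)%N -> translatable k op ->
  left_id e op -> right_id e op -> forall i j : Zn, op i j = i + j - e.
Proof.
move=> k_bd opT op1 opr1.
have row0 j : op 0 j = j + e * k%:R.
  by rewrite -[RHS]op1 (translatableE k_bd opT e); congr (op 0 _); ring.
have opE i j : op i j = j - i * k%:R + e * k%:R.
  by rewrite (translatableE k_bd opT i) row0.
(* The column of the identity at 0 locates e, then at 1 it determines k. *)
have e0 : e + e * k%:R = 0 by have := opr1 0; rewrite opE mul0r subr0.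
have kN1 : k%:R = -1 :> Zn.
  have := opr1 1; rewrite opE mul1r addrAC e0 add0r.
  by move/(congr1 -%R); rewrite opprK.
by move=> i j; rewrite opE kN1; ring.
Qed.

End Translatable.

(** Powers of the successor of [e] are [e + 1], [e + 2] and so on, which
    exhausts the residues. *)
Lemma shifted_addition_cyclic (m : nat) (e : 'I_m.+2)
    (op : 'I_m.+2 -> 'I_m.+2 -> 'I_m.+2) :
  (forall i j, op i j = i + j - e)%R -> is_cyclic_group op.
Proof.
move=> opE.
have opA : associative op by move=> x y z; rewrite !opE; ring.
have op1 : left_id e op by move=> x; rewrite !opE; ring.
pose inv (x : 'I_m.+2) := (e + e - x)%R.
have opV : left_inverse e inv op by move=> x; rewrite /inv !opE; ring.
exists e, inv, opA, op1, opV; apply/cyclicP.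
pose g : groupoid_group opA op1 opV := (e + 1)%R.
have gX t : (g ^+ t)%g = (e + t%:R)%R :> 'I_m.+2.
  elim: t => [|t IHt]; first by rewrite expg0 addr0.
  rewrite expgS [LHS](_ : _ = op g (g ^+ t)%g) // IHt opE /g -natr1.
  by ring.
exists g; apply/setP=> x; rewrite inE; apply/esym/cycleP.
exists (val ((x : 'I_m.+2) - e)%R).
by rewrite gX natr_Zp addrC subrK.
Qed.

Theorem theorem5p21 (n k : nat) (op : 'I_n -> 'I_n -> 'I_n) :
  1 <= k < n ->
  associative op ->
  paramedial op ->
  left_cancellative op ->
  translatable k op ->
  is_cyclic_group op.
Proof.
case: n op => [|[|m]] op k_bd opA opP opI opT; [lia | lia |].
have [e op1] := left_cancellative_left_id _ _ ord0 opA opI.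
have opr1 := paramedial_right_id _ _ _ opA opP op1.
exact: shifted_addition_cyclic (translatable_idE _ _ _ _ k_bd opT op1 opr1).
Qed.
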